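(* Let $d\ge1$ and let $\pi\colon X\to Y$ be a factor map between the topological dynamical systems $(X,T,\mathbb{Z}^d)$ and $(Y,S,\mathbb{Z}^d)$. Assume that $\pi$ is not bounded to one. Then the origin of $\mathbb{R}^d$ belongs to the convex hull of $\operatorname{ND}_{\ell_2}(X,\pi)$. In particular, the intersection of all the $\pi$-nonexpansive $\ell_2$ horoballs is empty: $$\bigcap_{v\in\operatorname{ND}_{\ell_2}(X,\pi)}\{y\in\mathbb{R}^d:\langle y,v\rangle<0\}=\emptyset.$$
   Context: A topological dynamical system $(X,T,\mathbb{Z}^d)$ is an action of $\mathbb{Z}^d$ by homeomorphisms $T_g$, $g\in\mathbb{Z}^d$, on a compact metric space $X$ with distance $\operatorname{dist}$. A factor map $\pi\colon X\to Y$ is a continuous onto map with $S_g\circ\pi=\pi\circ T_g$ for all $g\in\mathbb{Z}^d$. It is bounded to one if the cardinality of its fibers is uniformly bounded by a finite constant. For $\epsilon>0$, $\operatorname{ND}_{\ell_2}(X,\epsilon,\pi)$ is the set of unit vectors $v\in\mathbb{S}^{d-1}$ for which there exist two different points $x,y\in X$ with $\pi(x)=\pi(y)$ and $\operatorname{dist}(T_gx,T_gy)\le\epsilon$ for all $g\in\mathbb{Z}^d$ with $\langle g,v\rangle<0$. Set $\operatorname{ND}_{\ell_2}(X,\pi)=\bigcap_{\epsilon>0}\operatorname{ND}_{\ell_2}(X,\epsilon,\pi)$. The $\pi$-nonexpansive $\ell_2$ horoballs are the open half-spaces $\{y\in\mathbb{R}^d:\langle y,v\rangle<0\}$ with $v\in\operatorname{ND}_{\ell_2}(X,\pi)$.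 *)

(* Defs.v *)
From HB Require Import structures.
From mathcomp Require Import all_boot all_order all_algebra.
From mathcomp Require Import all_classical all_reals all_analysis.

Set Implicit Arguments.
Unset Strict Implicit.
Unset Printing Implicit Defensive.

Import Order.TTheory GRing.Theory Num.Theory.
Import numFieldNormedType.Exports.

Local Open Scope classical_set_scope.
Local Open Scope ring_scope.

Definition homeomorphism (X Y : topologicalType) (f : X -> Y) : Prop :=
  continuous f /\
  exists f' : Y -> X, [/\ continuous f', cancel f f' & cancel f' f].

Definition Zd_action (d : nat) (X : Type) (T : 'rV[int]_d -> X -> X) : Prop :=
  (forall x, T 0 x = x) /\ (forall g h x, T (g + h) x = T g (T h x)).

Definition topological_dynamical_system (R : realType) (d : nat)
    (X : metricType R) (T : 'rV[int]_d -> X -> X) : Prop :=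
  [/\ compact [set: X], Zd_action T & forall g, homeomorphism (T g)].

Definition factor_map (R : realType) (d : nat) (X Y : metricType R)
    (T : 'rV[int]_d -> X -> X) (S : 'rV[int]_d -> Y -> Y) (p : X -> Y) : Prop :=
  [/\ continuous p,
      set_surj [set: X] [set: Y] p &
      forall g x, S g (p x) = p (T g x)].

Definition bounded_to_one (X Y : Type) (p : X -> Y) : Prop :=
  exists n : nat, forall y : Y, (p @^-1` [set y] #<= `I_n)%card.

Definition dotp (R : realType) (d : nat) (u v : 'rV[R]_d) : R :=
  \sum_(i < d) u 0 i * v 0 i.

(* The library norm `|v| on row vectors is the sup norm, hence this one. *)
Definition l2norm (R : realType) (d : nat) (v : 'rV[R]_d) : R :=
  Num.sqrt (dotp v v).

Definition Zd_embed (R : realType) (d : nat) (g : 'rV[int]_d) : 'rV[R]_d :=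
  map_mx intr g.

Definition ND_l2_eps (R : realType) (d : nat) (X : metricType R) (Y : Type)
    (T : 'rV[int]_d -> X -> X) (p : X -> Y) (e : R) : set 'rV[R]_d :=
  [set v | l2norm v = 1 /\
    exists x y : X, [/\ x <> y, p x = p y &
      forall g : 'rV[int]_d, dotp (Zd_embed R g) v < 0 ->
        mdist (T g x) (T g y) <= e]].

Definition ND_l2 (R : realType) (d : nat) (X : metricType R) (Y : Type)
    (T : 'rV[int]_d -> X -> X) (p : X -> Y) : set 'rV[R]_d :=
  \bigcap_(e in [set e : R | 0 < e]) ND_l2_eps T p e.

Definition l2_horoball (R : realType) (d : nat) (v : 'rV[R]_d) : set 'rV[R]_d :=
  [set y | dotp y v < 0].

Definition convex_hull (R : realType) (d : nat) (A : set 'rV[R]_d) :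
    set 'rV[R]_d :=
  \bigcap_(B in [set B : set 'rV[R]_d | convex_set B /\ A `<=` B]) B.

(* Main.v *)
Require Import Defs.
From HB Require Import structures.
From mathcomp Require Import all_boot all_order all_algebra.
From mathcomp Require Import all_classical all_reals all_analysis.
From mathcomp Require Import ring lra zify.
Import Order.TTheory GRing.Theory Num.Theory.
Import numFieldNormedType.Exports.

Local Open Scope classical_set_scope.
Local Open Scope ring_scope.

(** Write v.w for the dot product and, for a given e > 0, call g a separating time
of the pair (x, y) when dist (T_g x, T_g y) > e.

Suppose that 0 lies outside some convex set containing ND.  For each e the set
ND_e is closed ([ND_l2_eps_closed]), so ND is compact, and then 0 can be
strictly separated from it ([strict_separation]): there are a unit vector w and
b > 0 with v.w <= - b on ND.  The compact set H of unit vectors v with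
v.w >= - b', where b' < b, misses ND, hence misses ND_e for one e > 0
([ND_l2_avoid]).

For v in H every pair of distinct points in a common fibre therefore has a
separating time g with g.v < 0.  By compactness of the set of pairs at distance
at least e, this becomes uniform ([uniform_descent]): from every separating time
g, and for every v in H, some g + f is again a separating time, with f of
bounded length and f.v <= - c for a fixed c > 0.

The key step is geometric ([ball_step]).  Consider large balls centred on the
ray spanned by w, whose radii grow slowly with the height of the centre.  Move
such a ball down a little: the points of the old ball lost by the new one lie
on its upper half or slightly below the equator, in directions v from the old
centre that belong to H, and the descent property along v takes a separating
time at such a point back into the new ball.  So if some high ball contains a separating time, then so does the
ball of a fixed radius r about the origin.  The balls fill an open cone around
w, hence any finite set of times can be translated into one of them.
Consequently ([walk_to_center]), any finitely many points of a fibre can be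
moved by a common T_h so that each two of them acquire a separating time of
norm at most r.

There are finitely many times of norm at most r, so X is covered by finitely
many sets within which no two points have a separating time of that size.  Their
number bounds the size of all the fibres, so the map is bounded to one.

For the intersection of the horoballs: if y.v < 0 for all v in ND, then
the half-space of all v with v.y < 0 is a convex set which contains ND, hence
contains 0, which is absurd. *)

(** * Dot product and Euclidean norm *)

Section DotProduct.
Context {R : realType} {d : nat}.
Implicit Types u v w : 'rV[R]_d.

Lemma dotpC u v : dotp u v = dotp v u.
Proof. by apply: eq_bigr => i _; rewrite mulrC. Qed.

Lemma dotpDl u v w : dotp (u + v) w = dotp u w + dotp v w.
Proof. by rewrite -big_split; apply: eq_bigr => i _; rewrite mxE mulrDl. Qed.

Lemma dotpZl a u v : dotp (a *: u) v = a * dotp u v.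
Proof. by rewrite mulr_sumr; apply: eq_bigr => i _; rewrite mxE mulrA. Qed.

Lemma dotpDr u v w : dotp u (v + w) = dotp u v + dotp u w.
Proof. by rewrite dotpC dotpDl !(dotpC _ u). Qed.

Lemma dotpZr a u v : dotp u (a *: v) = a * dotp u v.
Proof. by rewrite dotpC dotpZl dotpC. Qed.

Lemma dotpNl u v : dotp (- u) v = - dotp u v.
Proof. by rewrite -scaleN1r dotpZl mulN1r. Qed.

Lemma dotpNr u v : dotp u (- v) = - dotp u v.
Proof. by rewrite dotpC dotpNl dotpC. Qed.

Lemma dotp0l v : dotp 0 v = 0.
Proof. by rewrite -(scale0r (0 : 'rV[R]_d)) dotpZl mul0r. Qed.

Definition dotpE := (dotpDl, dotpDr, dotpZl, dotpZr, dotpNl, dotpNr).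

Lemma dotp_ge0 v : 0 <= dotp v v.
Proof. by apply: sumr_ge0 => i _; rewrite -expr2 sqr_ge0. Qed.

Lemma dotp_eq0 v : dotp v v = 0 -> v = 0.
Proof.
move=> /eqP; rewrite psumr_eq0 => [/allP v0|i _]; last by rewrite -expr2 sqr_ge0.
apply/rowP => i; rewrite mxE; apply/eqP.
by have := v0 i (mem_index_enum i); rewrite -expr2 sqrf_eq0.
Qed.

Lemma dotp_gt0 v : v != 0 -> 0 < dotp v v.
Proof.
move=> v0; rewrite lt_neqAle dotp_ge0 andbT eq_sym.
by apply: contra v0 => /eqP /dotp_eq0 ->.
Qed.

Lemma l2norm_ge0 v : 0 <= l2norm v.
Proof. exact: sqrtr_ge0. Qed.

Lemma l2norm_sqr v : l2norm v ^+ 2 = dotp v v.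
Proof. by rewrite sqr_sqrtr // dotp_ge0. Qed.

Lemma l2norm_le v (r : R) : 0 <= r -> (l2norm v <= r) = (dotp v v <= r ^+ 2).
Proof.
by move=> r0; rewrite -l2norm_sqr ler_sqr // nnegrE ?l2norm_ge0.
Qed.

Lemma l2norm1P v : l2norm v = 1 <-> dotp v v = 1.
Proof.
split=> [v1|v1]; first by rewrite -l2norm_sqr v1 expr1n.
by rewrite /l2norm v1 sqrtr1.
Qed.

(** Expand the square norm of the component of [v] orthogonal to [u], scaled by
[dotp u u] to avoid a division. *)
Lemma cauchy_schwarz u v : dotp u v <= l2norm u * l2norm v.
Proof.
have [->|u0] := eqVneq u 0.
  by rewrite dotp0l mulr_ge0 ?l2norm_ge0.
have uu := dotp_gt0 u u0.
apply: le_trans (ler_norm _) _.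
rewrite -(@ler_sqr _ _ (l2norm u * l2norm v)) ?nnegrE ?mulr_ge0 ?l2norm_ge0 //.
rewrite real_normK ?num_real // exprMn !l2norm_sqr.
have := dotp_ge0 (dotp u u *: v - dotp u v *: u).
rewrite !dotpE (dotpC v u) => h.
rewrite -subr_ge0 -(pmulr_rge0 _ uu); apply: le_trans h _.
by rewrite le_eqVlt; apply/orP; left; apply/eqP; ring.
Qed.

Lemma l2norm_triangle u v : l2norm (u + v) <= l2norm u + l2norm v.
Proof.
rewrite l2norm_le ?addr_ge0 ?l2norm_ge0 // !dotpE (dotpC v u) sqrrD !l2norm_sqr.
have := cauchy_schwarz u v; lra.
Qed.

Lemma l2normZ a v : l2norm (a *: v) = `|a| * l2norm v.
Proof. by rewrite /l2norm !dotpE mulrA -expr2 sqrtrM ?sqr_ge0 // sqrtr_sqr. Qed.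

Lemma l2normN v : l2norm (- v) = l2norm v.
Proof. by rewrite /l2norm !dotpE opprK. Qed.

Lemma l2norm_gt0 v : v != 0 -> 0 < l2norm v.
Proof. by move=> v0; rewrite sqrtr_gt0 dotp_gt0. Qed.

Lemma entry_le_l2norm v i : `|v 0 i| <= l2norm v.
Proof.
rewrite -ler_sqr ?nnegrE ?l2norm_ge0 // real_normK ?num_real // l2norm_sqr.
rewrite /dotp (bigD1 i) //= -expr2 lerDl.
by apply: sumr_ge0 => k _; rewrite -expr2 sqr_ge0.
Qed.

Lemma l2norm_bound v (r : R) :
  0 <= r -> (forall i, `|v 0 i| <= r) -> l2norm v <= d%:R * r.
Proof.
move=> r0 vr; rewrite l2norm_le ?mulr_ge0 // exprMn.
apply: (@le_trans _ _ (\sum_(i < d) r ^+ 2)).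
  apply: ler_sum => i _.
  by rewrite -expr2 -(real_normK (num_real (v 0 i))) ler_sqr ?nnegrE.
rewrite sumr_const card_ord -[X in X <= _]mulr_natl ler_wpM2r ?sqr_ge0 //.
by rewrite -natrX ler_nat; case: (d) => // n; rewrite expnS leq_pmulr.
Qed.

Lemma dotp_cvg {T : Type} {F : set_system T} {FF : Filter F}
    (f g : T -> 'rV[R]_d) (u v : 'rV[R]_d) :
  f @ F --> u -> g @ F --> v -> dotp (f t) (g t) @[t --> F] --> dotp u v.
Proof.
move=> fu gv; apply: cvg_big => [|i _]; first exact: add_continuous.
apply: cvgM.
  by apply: (cvg_comp f (fun m : 'rV[R]_d => m 0 i) fu); exact: coord_continuous.
by apply: (cvg_comp g (fun m : 'rV[R]_d => m 0 i) gv); exact: coord_continuous.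
Qed.

Lemma dotp_continuous u : continuous (dotp u).
Proof.
move=> v; apply: (@dotp_cvg _ (nbhs v) _ (fun=> u) id).
  exact: cvg_cst.
exact: cvg_id.
Qed.

Lemma dotp_diag_continuous : continuous (fun v : 'rV[R]_d => dotp v v).
Proof. by move=> v; apply: (@dotp_cvg _ (nbhs v) _ id id); exact: cvg_id. Qed.

Lemma closed_sphere : closed [set v : 'rV[R]_d | l2norm v = 1].
Proof.
have -> : [set v : 'rV[R]_d | l2norm v = 1] =
    (fun v => dotp v v) @^-1` [set 1].
  by apply/seteqP; split => v /l2norm1P.
apply: (proj1 (continuous_closedP _) dotp_diag_continuous).
exact: closed_eq.
Qed.

Lemma compact_sphere (A : set 'rV[R]_d) :
  closed A -> A `<=` [set v | l2norm v = 1] -> compact A.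
Proof.
move=> clA A1; apply: bounded_closed_compact => //.
exists 1; split=> // r r1 v /A1 /= v1.
rewrite [X in X <= _]/Num.norm /= mx_normrE; apply/bigmax_leP.
split=> [|[i j] _ /=]; first by rewrite ltW // (lt_trans ltr01).
by rewrite (ord1 i) ltW // (le_lt_trans _ r1) // -v1 entry_le_l2norm.
Qed.

End DotProduct.

(** * Strict separation of the origin from a compact set *)

Section ConvexSeparation.
Context {R : realType}.

Lemma convex_setP {V : lmodType R} {B : set V} (x y : V) (t : R) :
  convex_set B -> B x -> B y -> 0 <= t <= 1 -> B (t *: x + (1 - t) *: y).
Proof.
move=> cB Bx By t01.
have /(_ (mem_set Bx) (mem_set By)) := cB x y (Itv01 (andP t01).1 (andP t01).2).
by rewrite inE.
Qed.

(** Induction on the number of points: the last one is joined to the average of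
the others, whose weights are rescaled by their sum [s]. *)
Lemma convex_set_sum {V : lmodType R} {B : set V} n
    (l : 'I_n -> R) (x : 'I_n -> V) :
  convex_set B -> (forall i, 0 <= l i) -> \sum_(i < n) l i = 1 ->
  (forall i, B (x i)) -> B (\sum_(i < n) l i *: x i).
Proof.
move=> cB; elim: n l x => [|n IH] l x l0 l1 Bx.
  by move/eqP: l1; rewrite big_ord0 eq_sym oner_eq0.
rewrite big_ord_recr /=; rewrite big_ord_recr /= in l1.
set s := \sum_(i < n) _ in l1 *.
have s0 : 0 <= s by apply: sumr_ge0.
have lmax : l ord_max = 1 - s by rewrite -l1; ring.
have s1 : s <= 1 by rewrite -subr_ge0 -lmax.
have [sz|snz] := eqVneq s 0.
  have li i : l (widen_ord (leqnSn n) i) = 0.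
    by apply/eqP; move/eqP: sz; rewrite psumr_eq0 // => /allP /(_ i (mem_index_enum i)).
  rewrite big1 => [|i _]; last by rewrite li scale0r.
  by rewrite add0r lmax sz subr0 scale1r.
rewrite lmax.
pose inj := widen_ord (leqnSn n).
have -> : \sum_(i < n) l (inj i) *: x (inj i) =
    s *: \sum_(i < n) (s^-1 * l (inj i)) *: x (inj i).
  rewrite scaler_sumr; apply: eq_bigr => i _.
  by rewrite scalerA mulrA divff // mul1r.
apply: convex_setP => //; last by rewrite s0.
apply: IH => // [i|]; first by rewrite mulr_ge0 // invr_ge0.
by rewrite -mulr_sumr mulVf.
Qed.

(** The rows [(x i, 1)] form a matrix with more rows than columns, so its left
kernel is nonzero; a nonzero kernel vector has zero sum, hence a positive
entry. *)
Lemma affine_dependence {d n : nat} (x : 'I_n -> 'rV[R]_d) : (d.+1 < n)%N ->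
  exists m : 'I_n -> R, [/\ exists i, 0 < m i, \sum_(i < n) m i = 0 &
    \sum_(i < n) m i *: x i = 0].
Proof.
move=> dn.
pose A := row_mx (\matrix_i x i) (const_mx 1 : 'M[R]_(n, 1)).
have : kermx A != 0.
  rewrite kermx_eq0 /row_free neq_ltn; apply/orP; left.
  by apply: leq_ltn_trans (rank_leq_col _) _; rewrite addn1.
move=> /rowV0Pn [m mker m0].
move/sub_kermxP: mker; rewrite mul_mx_row => /eqP; rewrite row_mx_eq0.
move=> /andP [/eqP mx /eqP m1].
have msum : \sum_(i < n) m 0 i = 0.
  move/matrixP: m1 => /(_ 0 0); rewrite !mxE => m1.
  by rewrite -[RHS]m1; apply: eq_bigr => i _; rewrite mxE mulr1.
exists (m 0); split=> //; last first.
  by rewrite -[RHS]mx mulmx_sum_row; apply: eq_bigr => i _; rewrite rowK.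
apply: contrapT => mle.
have {}mle i : 0 <= - m 0 i.
  by rewrite oppr_ge0 leNgt; apply/negP => mi; apply: mle; exists i.
case/negP: m0; apply/eqP/rowP => i; rewrite mxE.
move/eqP: msum; rewrite -oppr_eq0 -sumrN psumr_eq0 // => /allP.
by move=> /(_ i (mem_index_enum i)); rewrite oppr_eq0 => /eqP.
Qed.

(** Subtract from the weights [l] the multiple of an affine dependence [m] that
first makes some weight vanish; the index [j] of that weight minimises
[l i / m i] over the positive [m i]. *)
Lemma caratheodory_step {d n : nat} (l : 'I_n.+1 -> R) (x : 'I_n.+1 -> 'rV[R]_d) :
  (d < n)%N -> (forall i, 0 <= l i) -> \sum_(i < n.+1) l i = 1 ->
  exists (j : 'I_n.+1) (l' : 'I_n -> R),
    [/\ forall i, 0 <= l' i, \sum_(i < n) l' i = 1 &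
    \sum_(i < n) l' i *: x (lift j i) = \sum_(i < n.+1) l i *: x i].
Proof.
move=> dn l0 l1; have [m [[i0 mi0] msum mx]] := affine_dependence x dn.
pose j := [arg min_(i < i0 | 0 < m i) (l i / m i)]%O.
have [mj jmin] : 0 < m j /\ forall i, 0 < m i -> l j / m j <= l i / m i.
  by rewrite /j; case: arg_minP.
pose t := l j / m j; have t0 : 0 <= t by rewrite divr_ge0 // ltW.
have lj : l j - t * m j = 0 by rewrite /t divfK ?gt_eqF // subrr.
exists j, (fun i => l (lift j i) - t * m (lift j i)); split.
- move=> i; rewrite subr_ge0; have [mi|mi] := ltP 0 (m (lift j i)).
    by rewrite -ler_pdivlMr // jmin.
  by apply: le_trans (l0 _); rewrite mulr_ge0_le0.
- have : \sum_(i < n.+1) (l i - t * m i) = 1.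
    by rewrite big_split /= sumrN -mulr_sumr msum l1 mulr0 subr0.
  by rewrite (bigD1_ord j) //= lj add0r.
have : \sum_(i < n.+1) (l i - t * m i) *: x i = \sum_(i < n.+1) l i *: x i.
  under eq_bigr do rewrite scalerBl -scalerA.
  by rewrite big_split /= sumrN -scaler_sumr mx scaler0 subr0.
by rewrite (bigD1_ord j) //= lj scale0r add0r.
Qed.

Definition convex_combinations {d} (n : nat) (K : set 'rV[R]_d) : set 'rV[R]_d :=
  [set y | exists (l : 'I_n -> R) (x : 'I_n -> 'rV[R]_d),
    [/\ forall i, 0 <= l i, \sum_(i < n) l i = 1, forall i, K (x i) &
      y = \sum_(i < n) l i *: x i]].

(** The matrices here have entries in an arbitrary topological space, so as to
apply to rows of vectors. *)
Lemma entry_continuous (T : topologicalType) m n (i : 'I_m) (j : 'I_n) :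
  continuous (fun M : 'M[T]_(m, n) => M i j).
Proof.
move=> M A MA; exists (fun i' j' => [set t | (i', j') = (i, j) -> A t]).
  move=> i' j'; have [[-> ->]|ne] := eqVneq (i', j') (i, j).
    by apply: filterS MA => t At _.
  by apply: filterS filterT => t _ e; rewrite e eqxx in ne.
by move=> N /(_ i j); apply.
Qed.

(** The set is the image of a compact set of pairs (weights, points) under a
continuous map. *)
Lemma compact_convex_combinations d n (K : set 'rV[R]_d) :
  compact K -> compact (convex_combinations n K).
Proof.
move=> cK.
pose D1 := [set l : 'rV[R]_n | forall i, `[0, 1]%classic (l ord0 i)].
pose D2 := [set x : 'rV['rV[R]_d]_n | forall i, K (x ord0 i)].
have cD : compact (D1 `*` D2).
  apply: compact_setX; first exact: (rV_compact (fun=> @segment_compact R 0 1)).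
  exact: (rV_compact (A := fun=> K) (fun=> cK)).
pose w (v : 'rV[R]_n * 'rV['rV[R]_d]_n) : R := \sum_(i < n) v.1 ord0 i.
pose c (v : 'rV[R]_n * 'rV['rV[R]_d]_n) : 'rV[R]_d :=
  \sum_(i < n) v.1 ord0 i *: v.2 ord0 i.
have fstc i : continuous (fun v : 'rV[R]_n * 'rV['rV[R]_d]_n => v.1 ord0 i).
  move=> v; apply: (cvg_comp fst (fun l : 'rV[R]_n => l ord0 i) cvg_fst).
  exact: entry_continuous.
have sndc i : continuous (fun v : 'rV[R]_n * 'rV['rV[R]_d]_n => v.2 ord0 i).
  move=> v; apply: (cvg_comp snd (fun x : 'rV['rV[R]_d]_n => x ord0 i) cvg_snd).
  exact: entry_continuous.
have wc : continuous w.
  by move=> v; apply: cvg_big => [|i _]; [exact: add_continuous|exact: fstc].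
have cc : continuous c.
  move=> v; apply: cvg_big => [|i _]; first exact: add_continuous.
  by apply: cvgZ; [exact: fstc|exact: sndc].
have -> : convex_combinations n K = c @` (w @^-1` [set 1] `&` (D1 `*` D2)).
  apply/seteqP; split=> [y [l [x [l0 l1 Kx ->]]]|y [[l x] [/= v1 [Dl Dx] <-]]].
    exists (\row_i l i, \row_i x i); last by apply: eq_bigr => i _; rewrite !mxE.
    split; first by rewrite /= /w -[RHS]l1; apply: eq_bigr => i _; rewrite mxE.
    split=> /= i; rewrite mxE //= in_itv /= l0 /=.
    by rewrite -l1 (bigD1 i) //= lerDl sumr_ge0.
  exists (fun i => l ord0 i), (fun i => x ord0 i); split=> // i.
  by have := Dl i; rewrite /= in_itv /= => /andP[].
apply: continuous_compact; first by apply: continuous_subspaceT.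
rewrite setIC; apply: compact_closedI => //.
by apply: (proj1 (continuous_closedP _) wc); exact: closed_eq.
Qed.

(** The convex hull of [K] consists of combinations of [d.+1] points, hence is
compact and has a point [p] of least norm, and [p] is nonzero because [B]
contains it.  Moving from [p] towards a point [v] of [K] stays in the hull by
[caratheodory_step], so minimality gives [dotp p p <= dotp v p]; the normal [w] is
[p] normalised and reversed. *)
Lemma strict_separation {d} (K B : set 'rV[R]_d) : (0 < d)%N -> compact K ->
  convex_set B -> K `<=` B -> ~ B 0 ->
  exists (w : 'rV[R]_d) (b : R),
    [/\ l2norm w = 1, 0 < b & forall v, K v -> dotp v w <= - b].
Proof.
move=> d0 cK cB KB B0.
(* Over an empty [K] any unit vector will do; [0 < d] provides one. *)
have [K0|/set0P [k0 Kk0]] := eqVneq K set0.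
  exists (delta_mx 0 (Ordinal d0)), 1; split=> //; last by move=> v; rewrite K0.
  apply/l2norm1P; rewrite /dotp (bigD1 (Ordinal d0)) //= !mxE !eqxx mulr1.
  by rewrite big1 ?addr0 // => i /negPf ine; rewrite !mxE ine andbF mulr0.
have [p ph pmin] : exists2 p, p \in convex_combinations d.+1 K &
    forall y, y \in convex_combinations d.+1 K -> dotp p p <= dotp y y.
  apply: (@compact_EVT_min _ R (fun y => dotp y y)).
  - exists k0, (fun i => (i == ord0)%:R), (fun=> k0); split=> //.
      by rewrite (bigD1 ord0) //= big1 ?addr0 // => i /negPf ->.
    rewrite (bigD1 ord0) //= scale1r big1 ?addr0 // => i /negPf ->.
    by rewrite scale0r.
  - exact: compact_convex_combinations.
  - by apply: continuous_subspaceT; exact: dotp_diag_continuous.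
have {ph} [l [x [l0 l1 Kx pE]]] := set_mem ph.
have p0 : p != 0.
  apply/eqP => pz; apply: B0; rewrite -pz pE.
  by apply: convex_set_sum => // i; exact/KB/Kx.
have pp := dotp_gt0 p p0.
have np := l2norm_gt0 p p0.
have pv v : K v -> dotp p p <= dotp v p.
  move=> Kv; rewrite -subr_ge0; set a := dotp v p - dotp p p.
  set q := dotp (v - p) (v - p).
  (* Minimality of [p] along the segment from [p] to [v], divided by [t]. *)
  have key t : 0 < t <= 1 -> 0 <= 2 * a + t * q.
    move=> /andP [t0 t1].
    pose l' (i : 'I_d.+2) := if unlift ord0 i is Some k then (1 - t) * l k else t.
    pose x' (i : 'I_d.+2) := if unlift ord0 i is Some k then x k else v.
    have l'0 i : 0 <= l' i.
      rewrite /l'; case: unliftP => [k _|_]; last exact: ltW.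
      by rewrite mulr_ge0 // subr_ge0.
    have l'1 : \sum_(i < d.+2) l' i = 1.
      rewrite big_ord_recl /l' unlift_none.
      under eq_bigr do rewrite liftK.
      by rewrite -mulr_sumr l1 mulr1 addrC subrK.
    have yE : \sum_(i < d.+2) l' i *: x' i = p + t *: (v - p).
      rewrite big_ord_recl /l' /x' unlift_none.
      under eq_bigr do rewrite liftK -scalerA.
      rewrite -scaler_sumr -pE scalerBl scale1r scalerBr.
      by rewrite addrCA addrA.
    have [j [l2 [l20 l21 l2E]]] := caratheodory_step l' x' (leqnn _) l'0 l'1.
    have yh : convex_combinations d.+1 K (p + t *: (v - p)).
      exists l2, (fun i => x' (lift j i)); split=> //; last by rewrite l2E.
      by move=> i; rewrite /x'; case: unlift.
    have := pmin _ (mem_set yh); rewrite -subr_ge0.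
    rewrite -(pmulr_rge0 (2 * a + t * q) t0); congr (0 <= _).
    by rewrite /a /q !dotpE (dotpC p v); ring.
  (* If [a < 0], then [key] fails at [t = min (1, - a / q)]. *)
  rewrite leNgt; apply/negP => an.
  have q0 : 0 <= q by exact: dotp_ge0.
  have [qa|qa] := leP q (- a).
    by have := key 1; rewrite lexx ltr01 => /(_ isT); lra.
  have qp : 0 < q by lra.
  have /key : 0 < - a / q <= 1.
    by rewrite divr_gt0 ?oppr_gt0 // ler_pdivrMr // mul1r ltW.
  by rewrite divfK ?gt_eqF //; lra.
exists (- (l2norm p)^-1 *: p), (l2norm p); split=> //.
  by rewrite l2normZ normrN gtr0_norm ?invr_gt0 // mulVf // gt_eqF.
move=> v /pv h; rewrite dotpZr mulNr lerN2 mulrC ler_pdivlMr //.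
by rewrite -expr2 l2norm_sqr.
Qed.

End ConvexSeparation.

(** * Descending sets of lattice points *)

Section Walk.
Context {R : realType} {d : nat}.
Implicit Types (w v : 'rV[R]_d) (g f h : 'rV[int]_d).

Lemma Zd_embedD g h : Zd_embed R (g + h) = Zd_embed R g + Zd_embed R h.
Proof. by apply/rowP => i; rewrite !mxE intrD. Qed.

Lemma Zd_embedB g h : Zd_embed R (g - h) = Zd_embed R g - Zd_embed R h.
Proof. by apply/rowP => i; rewrite !mxE intrB. Qed.

(** The abstract form of expansiveness used by the geometric argument, with [A]
the separating times of a pair and [V] the directions outside [ND_l2_eps]; only
the bounds on the jump [f] are uniform, as in a compactness argument. *)
Definition descends (A : set 'rV[int]_d) (V : set 'rV[R]_d) (M c : R) :=
  forall g v, A g -> V v -> exists f,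
    [/\ l2norm (Zd_embed R f) <= M, dotp (Zd_embed R f) v <= - c & A (g + f)].

(** The ball of radius [rho] about [s *: w] is lowered by [eta = c / 4] while its
radius shrinks by [k = eta * b / 4].  If [g] leaves the ball, comparing the
squared distances to the two centres shows that its offset [B] from the old
centre satisfies [dotp B w >= - b * l2norm B], so descent applies in the
direction of [B]: it shortens the offset by almost [c], more than the
displacement [eta] of the centre and the loss [k] of radius together.  The lower
bound on [rho] makes the second-order terms [eta ^+ 2], [c ^+ 2] and [M ^+ 2]
negligible. *)
Lemma ball_step w (b c M s rho : R) (A : set 'rV[int]_d) :
  l2norm w = 1 -> 0 < b <= 1 -> 0 < c -> 0 <= M ->
  c / b + c + M ^+ 2 / c <= rho ->
  descends A [set v | l2norm v = 1 /\ - b <= dotp v w] M c ->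
  (exists2 g, A g & l2norm (Zd_embed R g - s *: w) <= rho) ->
  exists2 g, A g &
    l2norm (Zd_embed R g - (s - c / 4) *: w) <= rho - (c / 4) * (b / 4).
Proof.
move=> w1 /andP [b0 b1] c0 M0 rhoge desc [g Ag gle].
have [b0' c0'] := (ltW b0, ltW c0).
set eta := c / 4; set k := eta * (b / 4).
have eta0 : 0 < eta by rewrite divr_gt0.
have k0 : 0 < k by rewrite mulr_gt0 // divr_gt0.
have keta : k <= eta.
  by rewrite ger_pMr // ler_pdivrMr // mul1r (le_trans b1) // ler1n.
have cE : c = 4 * eta by rewrite /eta; field.
have rho_b : c <= b * rho.
  have : c / b <= rho.
    by apply: le_trans rhoge; rewrite -addrA lerDl addr_ge0 ?divr_ge0 ?sqr_ge0.
  by rewrite ler_pdivrMr // mulrC.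
have rho_c : c ^+ 2 + M ^+ 2 <= c * rho.
  have : c + M ^+ 2 / c <= rho.
    by apply: le_trans rhoge; rewrite -addrA lerDr divr_ge0.
  move=> /(ler_wpM2l (ltW c0)); rewrite mulrDr mulrCA divff ?gt_eqF // mulr1.
  by rewrite expr2.
have rho0 : 0 <= rho.
  by rewrite -(pmulr_rge0 _ c0); apply: le_trans rho_c; rewrite addr_ge0 ?sqr_ge0.
have rhoc : c <= rho by apply: le_trans rho_b _; rewrite ler_piMl.
set B := Zd_embed R g - s *: w in gle *.
have shift a : Zd_embed R (g + a) - (s - eta) *: w = B + Zd_embed R a + eta *: w.
  by rewrite Zd_embedD scalerBl opprB (addrC (eta *: w)) addrACA addrA.
have shift0 : Zd_embed R g - (s - eta) *: w = B + eta *: w.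
  by rewrite scalerBl opprB (addrC (eta *: w)) addrA.
(* Otherwise expanding dot products would unfold [B]. *)
clearbody B.
have [small|big] := leP (l2norm (B + eta *: w)) (rho - k).
  by exists g => //; rewrite shift0.
have w_eta : l2norm (eta *: w) = eta by rewrite l2normZ w1 mulr1 gtr0_norm.
have L_lo : rho - 2 * eta <= l2norm B.
  have := l2norm_triangle B (eta *: w); rewrite w_eta; lra.
have L0 : 0 < l2norm B by lra.
have ww : dotp w w = 1 by apply/l2norm1P.
have Bw : - b * l2norm B <= dotp B w.
  have big2 : (rho - k) ^+ 2 < l2norm B ^+ 2 + 2 * eta * dotp B w + eta ^+ 2.
    have -> : l2norm B ^+ 2 + 2 * eta * dotp B w + eta ^+ 2 =
        l2norm (B + eta *: w) ^+ 2.
      by rewrite !l2norm_sqr !dotpE (dotpC w B) ww; ring.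
    by rewrite ltr_sqr ?nnegrE ?l2norm_ge0 //; lra.
  have L2 : l2norm B ^+ 2 <= rho ^+ 2 by rewrite ler_sqr ?nnegrE ?l2norm_ge0.
  have : - 2 * rho * k - eta ^+ 2 <= 2 * eta * dotp B w.
    by have := sqr_ge0 k; rewrite sqrrB in big2; lra.
  have -> : - 2 * rho * k - eta ^+ 2 = 2 * eta * (- (b * rho / 4) - eta / 2).
    by rewrite /k; field.
  rewrite ler_pM2l; last by rewrite mulr_gt0.
  move=> h; apply: le_trans h.
  have : b * (rho - 2 * eta) <= b * l2norm B by rewrite ler_pM2l.
  have : b * eta <= eta by rewrite ger_pMl.
  lra.
pose v := (l2norm B)^-1 *: B.
have v1 : l2norm v = 1 by rewrite l2normZ gtr0_norm ?invr_gt0 // mulVf // gt_eqF.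
have vw : - b <= dotp v w.
  by rewrite dotpZl mulrC ler_pdivlMr.
have [f [fM fv Agf]] := desc g v Ag (conj v1 vw).
exists (g + f) => //; rewrite shift.
apply: le_trans (l2norm_triangle _ _) _; rewrite w_eta -lerBrDr.
rewrite l2norm_le; last by lra.
have fB : dotp (Zd_embed R f) B <= - c * l2norm B.
  by move: fv; rewrite dotpZr mulrC ler_pdivrMr.
have fM2 : dotp (Zd_embed R f) (Zd_embed R f) <= M ^+ 2 by rewrite -l2norm_le.
have L2 : dotp B B <= rho ^+ 2 by rewrite -l2norm_le.
rewrite !dotpE (dotpC B).
have cL : c * (rho - 2 * eta) <= c * l2norm B by rewrite ler_pM2l.
have : rho * (k + eta) <= rho * (2 * eta) by rewrite ler_wpM2l //; lra.
have := sqr_ge0 (k + eta).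
have -> : (rho - k - eta) ^+ 2 = rho ^+ 2 - 2 * (rho * (k + eta)) + (k + eta) ^+ 2.
  by ring.
have e2 : c * (2 * eta) = c ^+ 2 / 2 by rewrite /eta; field.
have e3 : rho * (2 * eta) = c * rho / 2 by rewrite /eta; field.
rewrite mulrBr e2 in cL; rewrite e3; lra.
Qed.

Lemma round_down v : exists h, l2norm (Zd_embed R h - v) <= d%:R.
Proof.
exists (\row_i Num.floor (v 0 i)); rewrite -[d%:R]mulr1.
apply: l2norm_bound => // i; rewrite !mxE distrC ger0_norm ?subr_ge0 ?floor_le //.
by have := floorD1_gt (v 0 i); rewrite intrD; lra.
Qed.

(** The radius [r] is chosen before the family [A]; this uniformity is what
bounds the fibres.  The translation [h] is the entrywise floor of
[- (n * c / 4) *: w], with [n] so large that the translate by [- h] of one chosen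
point of each [A i] lies in the ball about [(n * c / 4) *: w], from which
[ball_step] descends [n] times. *)
Lemma walk_to_center w (b c M : R) :
  l2norm w = 1 -> 0 < b <= 1 -> 0 < c -> 0 <= M ->
  exists r, forall (I : finType) (P : pred I) (A : I -> set 'rV[int]_d),
    (forall i, P i -> A i !=set0 /\
      descends (A i) [set v | l2norm v = 1 /\ - b <= dotp v w] M c) ->
    exists h, forall i, P i ->
      exists2 g, A i (g + h) & l2norm (Zd_embed R g) <= r.
Proof.
move=> w1 /[dup] b01 /andP [b0 b1] c0 M0.
set V := [set v | _].
pose r := c / b + c + M ^+ 2 / c; exists r => I P A hA.
set k := c / 4 * (b / 4).
have k0 : 0 < k by rewrite mulr_gt0 // divr_gt0.
have down n (B : set 'rV[int]_d) : descends B V M c ->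
    (exists2 g, B g & l2norm (Zd_embed R g - (n%:R * (c / 4)) *: w) <= r + n%:R * k) ->
    exists2 g, B g & l2norm (Zd_embed R g) <= r.
  move=> dB; elim: n => [|n IH].
    by move=> [g Bg]; rewrite !mul0r scale0r subr0 addr0 => gr; exists g.
  move=> /(ball_step w b c M _ _ _ w1 b01 c0 M0 _ dB) [|g Bg gle].
    by rewrite lerDl mulr_ge0 // ltW.
  apply: IH; exists g => //; move: gle.
  by rewrite -natr1 !mulrDl !mul1r addrK addrA addrK.
have /choice [a aP] : forall i, exists g, P i -> A i g.
  move=> i; case Pi : (P i); last by exists 0.
  by have [[g Ag] _] := hA i Pi; exists g.
pose D := \sum_i l2norm (Zd_embed R (a i)) + d%:R.
have D0 : 0 <= D by rewrite addr_ge0 // sumr_ge0 // => i _; exact: l2norm_ge0.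
pose n := (Num.truncn (D / k)).+1.
have nD : D <= r + n%:R * k.
  have : D <= n%:R * k by rewrite -ler_pdivrMr // ltW // truncnS_gt.
  have : 0 <= r by rewrite !addr_ge0 ?divr_ge0 ?sqr_ge0 // ltW.
  lra.
have [h hh] := round_down (- ((n%:R * (c / 4)) *: w)).
exists h => i Pi; have [_ dA] := hA i Pi.
apply: (down n [set g | A i (g + h)]).
  move=> g v Agh Vv; have [f [fM fv Af]] := dA _ _ Agh Vv.
  by exists f; split=> //; rewrite /= addrAC.
exists (a i - h); first by rewrite /= subrK; exact: aP.
apply: le_trans nD; rewrite Zd_embedB -addrA -opprD.
apply: le_trans (l2norm_triangle _ _) _; apply: lerD.
  by rewrite (bigD1 i) //= lerDl sumr_ge0 // => j _; exact: l2norm_ge0.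
by rewrite l2normN; move: hh; rewrite opprK.
Qed.

End Walk.

(** * Compactness and cardinality *)

Section Compactness.
Context {R : realType}.

Lemma mdist_cvg {X : metricType R} {T : Type} {F : set_system T} {FF : Filter F}
    (f g : T -> X) (x y : X) :
  f @ F --> x -> g @ F --> y -> mdist (f t) (g t) @[t --> F] --> mdist x y.
Proof.
move=> fx gy; apply/cvgrPdist_lt => e e0; near=> t.
have xf : mdist x (f t) < e / 2.
  near: t; apply: (metricType_numDomainType.cvgr_dist_lt fx).
  by rewrite divr_gt0.
have yg : mdist y (g t) < e / 2.
  near: t; apply: (metricType_numDomainType.cvgr_dist_lt gy).
  by rewrite divr_gt0.
have := metric_triangle x (f t) y; have := metric_triangle (f t) (g t) y.
have := metric_triangle (f t) x (g t); have := metric_triangle x y (g t).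
rewrite (metric_sym (f t) x) (metric_sym (g t) y) => h1 h2 h3 h4.
by rewrite ltr_norml; lra.
Unshelve. all: by end_near. Qed.

(** A form of the finite subcover property for spaces without a base point: the
sequences of points, ordered by inclusion, form a filter along which the
property of being covered is eventually true near each point. *)
Lemma compact_finite_net {T : topologicalType} (U : T -> set T) :
  compact [set: T] -> (forall x, nbhs x (U x)) ->
  exists s : seq T, forall x, exists2 c, c \in s & U c x.
Proof.
move=> cT nU.
pose F := filter_from [set: seq T] (fun s => [set s' : seq T | {subset s <= s'}]).
have FF : Filter F.
  apply: filter_fromT_filter; first by exists [::].
  move=> s1 s2; exists (s1 ++ s2) => s /= s12.
  by split=> x xs; apply: s12; rewrite mem_cat xs ?orbT.
have := (compact_near_coveringP _).1 cT _ F
  (fun s x => exists2 c, c \in s & U c x) FF.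
case.
  move=> x _; exists (U x, [set s : seq T | {subset [:: x] <= s}]).
    by split; [exact: nU|exists [:: x]].
  by move=> [y s] [/= Uy sx]; exists x => //; apply: sx; rewrite inE.
by move=> s _ /(_ s) h; exists s => x; exact: h.
Qed.

Lemma card_gt_uniq {T : choiceType} (A : set T) (n : nat) :
  ~ (A #<= `I_n)%card ->
  exists s : seq T, [/\ uniq s, forall x, x \in s -> A x & (n < size s)%N].
Proof.
move=> An; have [/finite_fsetP [B AB]|infA] := pselect (finite_set A); last first.
  have [B BA Bn] := infinite_set_fset n.+1 infA.
  by exists (finmap.enum_fset B); split; [exact: finmap.fset_uniq|exact: BA|].
exists (finmap.enum_fset B); split; first exact: finmap.fset_uniq.
  by rewrite AB.
rewrite ltnNge; apply/negP => Bn; apply: An.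
by rewrite AB (card_le_eql (introT card_eq_fsetP erefl)) card_le_II.
Qed.
End Compactness.

(** * Separating times of a factor map *)

Section Dynamics.
Context {R : realType} {d : nat} {X Y : metricType R}.
Context {T : 'rV[int]_d -> X -> X} {p : X -> Y}.
Hypothesis Tcompact : compact [set: X].
Hypothesis Taction : Zd_action T.
Hypothesis Tcont : forall g, continuous (T g).
Hypothesis pcont : continuous p.
Hypothesis pequiv : forall g x y, p x = p y -> p (T g x) = p (T g y).

Definition separated (e : R) (x y : X) : set 'rV[int]_d :=
  [set g | e < mdist (T g x) (T g y)].

Lemma separatedD e x y g h :
  separated e (T h x) (T h y) g <-> separated e x y (g + h).
Proof. by rewrite /separated /= !Taction.2. Qed.

Lemma fiber_pairs_compact (e : R) :
  compact [set z : X * X | p z.1 = p z.2 /\ e <= mdist z.1 z.2].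
Proof.
have -> : [set z : X * X | p z.1 = p z.2 /\ e <= mdist z.1 z.2] =
    (fun z => mdist (p z.1) (p z.2)) @^-1` [set 0] `&`
    (fun z => mdist z.1 z.2) @^-1` [set r | e <= r].
  apply/seteqP; split=> z /= [pz ez]; split=> //; last exact: mdist_positivity.
  by rewrite pz mdistxx.
have cXX : compact [set: X * X] by rewrite -setXTT; exact: compact_setX.
apply: subclosed_compact cXX _ => //; apply: closedI.
  apply: (proj1 (continuous_closedP
    (fun z : X * X => mdist (p z.1) (p z.2)))); last exact: closed_eq.
  move=> z; apply: (@mdist_cvg R Y _ (nbhs z) _ (fun z => p z.1) (fun z => p z.2)).
    by apply: (cvg_comp fst p cvg_fst); exact: pcont.
  by apply: (cvg_comp snd p cvg_snd); exact: pcont.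
apply: (proj1 (continuous_closedP (fun z : X * X => mdist z.1 z.2))).
  move=> z; apply: (@mdist_cvg R X _ (nbhs z) _ fst snd).
    exact: cvg_fst.
  exact: cvg_snd.
exact: closed_ge.
Qed.

(** For a pair at distance at least [e] in a common fibre and for [v] in [H],
nonmembership in [ND_l2_eps] yields a jump [f]; the same [f] serves for all
nearby pairs and directions, so finitely many jumps suffice by compactness.
Applied to the pair [(T g x, T g y)], this gives the descent at [g].  A single
integer [n] bounds both the length of the jumps, by [n], and their gain from
below, by [n.+1%:R^-1]. *)
Lemma uniform_descent (e : R) (H : set 'rV[R]_d) : 0 < e -> compact H ->
  (forall v, H v -> l2norm v = 1 /\ ~ ND_l2_eps T p e v) ->
  exists M c : R, [/\ 0 <= M, 0 < c &
    forall x y, p x = p y -> descends (separated e x y) H M c].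
Proof.
move=> e0 cH HND.
pose K := [set z : X * X | p z.1 = p z.2 /\ e <= mdist z.1 z.2] `*` H.
have cK : compact K by apply: compact_setX => //; exact: fiber_pairs_compact.
pose good (n : nat) (z : (X * X) * 'rV[R]_d) := exists f : 'rV[int]_d,
  [/\ l2norm (Zd_embed R f) <= n%:R, dotp (Zd_embed R f) z.2 <= - n.+1%:R^-1 &
    separated e z.1.1 z.1.2 f].
have : \forall n \near \oo, K `<=` good n.
  apply: ((compact_near_coveringP _).1 cK) => -[[x y] v] /= [[/= pxy exy] Hv].
  have [v1 nv] := HND v Hv.
  have [f [fv fs]] : exists f, dotp (Zd_embed R f) v < 0 /\ separated e x y f.
    apply: contrapT => nf; apply: nv; split=> //; exists x, y; split=> //.
      by move=> xy; move: exy; rewrite xy mdistxx leNgt e0.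
    by move=> g gv; rewrite leNgt; apply/negP => gs; apply: nf; exists g.
  exists ([set z | dotp (Zd_embed R f) z.2 < dotp (Zd_embed R f) v / 2 /\
                   e < mdist (T f z.1.1) (T f z.1.2)],
          [set n | l2norm (Zd_embed R f) <= n%:R /\
                   n.+1%:R^-1 < - (dotp (Zd_embed R f) v / 2)]).
    split=> /=; apply: filterI.
    - have : dotp (Zd_embed R f) z.2 @[z --> nbhs ((x, y), v)] -->
          dotp (Zd_embed R f) v.
        by apply: (cvg_comp snd (dotp (Zd_embed R f)) cvg_snd); exact: dotp_continuous.
      by move=> /cvgr_lt; apply; lra.
    - have : mdist (T f z.1.1) (T f z.1.2) @[z --> nbhs ((x, y), v)] -->
          mdist (T f x) (T f y).
        apply: mdist_cvg.
          apply: (cvg_comp (fun z : (X * X) * 'rV[R]_d => z.1.1) (T f)); last exact: Tcont.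
          by apply: (cvg_comp fst fst); exact: cvg_fst.
        apply: (cvg_comp (fun z : (X * X) * 'rV[R]_d => z.1.2) (T f)); last exact: Tcont.
        by apply: (cvg_comp fst snd); [exact: cvg_fst|exact: cvg_snd].
      by move=> /cvgr_gt; apply.
    - exact: nbhs_infty_ger.
    - have fv2 : 0 < - (dotp (Zd_embed R f) v / 2) by lra.
      exact: near_infty_natSinv_lt (PosNum fv2).
  move=> [z n] /= [[fz fs'] [fn fn']]; exists f; split=> //=.
  by move: fn'; set q := _^-1; lra.
move=> [n _ /(_ n (leqnn n)) Kn].
exists n%:R, n.+1%:R^-1; split=> // x y pxy g v gs Hv.
have [|f [fn fv fs]] := Kn ((T g x, T g y), v).
  by split=> //; split=> /=; [exact: pequiv|exact: ltW].
by exists f; split=> //; rewrite addrC; apply/separatedD.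
Qed.

(** A limit of bad pairs may collapse to a single point, so closedness is not
immediate.  Instead, for [v] outside, the uniform descent along [v] persists
along every nearby [v'] with gain [c / 2]; iterating it from any separating time
reaches the half-space of [v']. *)
Lemma ND_l2_eps_closed (e : R) : 0 < e -> closed (ND_l2_eps T p e).
Proof.
move=> e0; rewrite -openC openE => v nv; rewrite /interior.
have [v1|v1] := pselect (l2norm v = 1); last first.
  apply: (@filterS _ _ _ (~` [set v | l2norm v = 1])) => [v' v'1 [] //|].
  by apply: open_nbhs_nbhs; split=> //; rewrite openC; exact: closed_sphere.
have [M [c [M0 c0 desc]]] : exists M c : R, [/\ 0 <= M, 0 < c &
    forall x y, p x = p y -> descends (separated e x y) [set v] M c].
  by apply: uniform_descent => //; [exact: compact_set1|move=> _ ->].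
(* A jump has norm at most [M], so moving [v] by [del] changes its gain by at
   most [c / 2]; the added 1 covers the case [M = 0]. *)
pose del := c / (2 * (M + 1)).
have M10 : 0 < 2 * (M + 1) by rewrite mulr_gt0 // ltr_wpDl.
have del0 : 0 < del by rewrite divr_gt0.
have near_v : \forall v' \near v, dotp (v' - v) (v' - v) < del ^+ 2.
  have : dotp (v' - v) (v' - v) @[v' --> v] --> dotp (v - v) (v - v).
    apply: (@dotp_cvg _ _ _ (nbhs v) _ (fun v' => v' - v) (fun v' => v' - v));
      by apply: cvgB; [exact: cvg_id|exact: cvg_cst].
  by move=> /cvgr_lt; apply; rewrite subrr dotp0l exprn_gt0.
apply: filterS near_v => v' v'v [v'1 [x [y [xy pxy close]]]].
have [g0 g0s] : separated e x y !=set0.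
  apply: contrapT => ns; apply: nv; split=> //; exists x, y; split=> // g _.
  by rewrite leNgt; apply/negP => gs; apply: ns; exists g.
have walk k : exists2 g, separated e x y g &
    dotp (Zd_embed R g) v' <= dotp (Zd_embed R g0) v' - k%:R * (c / 2).
  elim: k => [|k [g gs gle]]; first by exists g0 => //; rewrite mul0r subr0.
  have [f [fM fv fs]] := desc x y pxy g v gs erefl.
  exists (g + f) => //; rewrite Zd_embedD dotpDl -natr1 mulrDl mul1r.
  have fv' : dotp (Zd_embed R f) (v' - v) <= c / 2.
    apply: le_trans (cauchy_schwarz _ _) _.
    apply: (@le_trans _ _ ((M + 1) * del)).
      apply: ler_pM; rewrite ?l2norm_ge0 //; first by rewrite ler_wpDr.
      by rewrite l2norm_le ltW.
    suff -> : (M + 1) * del = c / 2 by [].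
    by rewrite /del; field; rewrite gt_eqF // ltr_wpDl.
  by rewrite dotpDr dotpNr in fv'; lra.
pose D := dotp (Zd_embed R g0) v'.
have [g gs gle] := walk (Num.truncn (D / (c / 2))).+1.
have : dotp (Zd_embed R g) v' < 0.
  apply: le_lt_trans gle _; rewrite subr_lt0 -ltr_pdivrMr ?divr_gt0 //.
  exact: truncnS_gt.
by move=> /close; rewrite leNgt; apply/negP; rewrite negbK.
Qed.

Lemma ND_l2_compact : compact (ND_l2 T p).
Proof.
apply: compact_sphere => [|v /(_ 1 ltr01) []//].
by apply: closed_bigI => e e0; exact: ND_l2_eps_closed.
Qed.

Lemma ND_l2_eps_mono (e e' : R) : e <= e' -> ND_l2_eps T p e `<=` ND_l2_eps T p e'.
Proof.
move=> ee' v [v1 [x [y [xy pxy close]]]]; split=> //; exists x, y; split=> // g gv.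
by apply: le_trans ee'; exact: close.
Qed.

Lemma ND_l2_avoid (H : set 'rV[R]_d) : compact H -> H `&` ND_l2 T p = set0 ->
  exists2 e : R, 0 < e & forall v, H v -> ~ ND_l2_eps T p e v.
Proof.
move=> cH HND.
have : \forall n \near \oo, H `<=` (fun v => ~ ND_l2_eps T p n.+1%:R^-1 v).
  apply: ((compact_near_coveringP _).1 cH) => v Hv.
  have [e e0 ne] : exists2 e, 0 < e & ~ ND_l2_eps T p e v.
    apply: contrapT => h; suff : set0 v by [].
    rewrite -HND; split=> // e e0; apply: contrapT => ne; apply: h.
    by exists e.
  exists (~` ND_l2_eps T p e, [set n | n.+1%:R^-1 < e]).
    split=> /=; last exact: near_infty_natSinv_lt (PosNum e0).
    by apply: open_nbhs_nbhs; split=> //; rewrite openC; exact: ND_l2_eps_closed.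
  by move=> [v' n] /= [nv' /ltW ne'] /(ND_l2_eps_mono _ _ ne').
by move=> [n _ /(_ n (leqnn n)) Hn]; exists n.+1%:R^-1.
Qed.

(** Only finitely many lattice points have norm at most [r]: each of them is
[gam m] for some [m], the entries being shifted by [n] to be nonnegative. *)
Lemma finite_ball_near (e r : R) (c : X) : 0 < e ->
  \forall x \near c, forall g, l2norm (Zd_embed R g) <= r ->
    mdist (T g c) (T g x) < e.
Proof.
move=> e0.
pose n := Num.truncn r.
pose gam (m : {ffun 'I_d -> 'I_(n + n).+1}) : 'rV[int]_d := \row_i ((m i)%:Z - n%:Z).
have : \forall x \near c, forall m, mdist (T (gam m) c) (T (gam m) x) < e.
  apply: filter_forall => m.
  exact: (metricType_numDomainType.cvgr_dist_lt (Tcont (gam m) c)).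
apply: filterS => x hx g gr.
have gn i : (`|g 0%R i|%N <= n)%N.
  have r0 : 0 <= r by apply: le_trans gr; exact: l2norm_ge0.
  rewrite truncn_ge_nat //; apply: le_trans gr; rewrite natr_absz intr_norm.
  by have := entry_le_l2norm (Zd_embed R g) i; rewrite mxE.
have -> : g = gam [ffun i => inord (absz (g 0 i + n%:Z))].
  apply/rowP => i; rewrite !mxE ffunE inordK; by have := gn i; lia.
exact: hx.
Qed.

(** The bound on the fibres is the size of a finite net [s] of [X] for closeness
up to [e / 2] at all times of norm at most [r].  More points than that in one
fibre, moved by the [h] of [walk_to_center], would put two of them near the same
member of the net, against their separating time of norm at most [r]. *)
Lemma bounded_to_one_of_half_space (w : 'rV[R]_d) (b : R) :
  l2norm w = 1 -> 0 < b -> (forall v, ND_l2 T p v -> dotp v w <= - b) ->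
  bounded_to_one p.
Proof.
move=> w1 b0 NDw.
(* The walk requires a margin of at most 1. *)
pose b' := Num.min (b / 2) 1.
have b'01 : 0 < b' <= 1 by rewrite lt_min ge_min lexx orbT divr_gt0 ?ltr01.
have b'b : b' < b by rewrite gt_min; apply/orP; left; lra.
pose H := [set v | l2norm v = 1 /\ - b' <= dotp v w].
have cH : compact H.
  apply: compact_sphere => [|v []//]; apply: closedI; first exact: closed_sphere.
  apply: ((continuous_closedP (fun v => dotp v w)).1 _ [set t | - b' <= t]).
    move=> v; apply: (@dotp_cvg _ _ _ (nbhs v) _ id (fun=> w)).
      exact: cvg_id.
    exact: cvg_cst.
  exact: closed_ge.
have [e e0 He] : exists2 e : R, 0 < e & forall v, H v -> ~ ND_l2_eps T p e v.
  apply: ND_l2_avoid => //; rewrite -subset0 => v [[_ vw] /NDw]; lra.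
have [M [c [M0 c0 desc]]] : exists M c : R, [/\ 0 <= M, 0 < c &
    forall x y, p x = p y -> descends (separated e x y) H M c].
  by apply: uniform_descent => // v Hv; split; [case: Hv|exact: He].
have [r walk] := walk_to_center w b' c M w1 b'01 c0 M0.
have [s net] := compact_finite_net
  (fun z => [set x | forall g, l2norm (Zd_embed R g) <= r ->
     mdist (T g z) (T g x) < e / 2]) Tcompact
  (fun z => finite_ball_near _ r z (divr_gt0 e0 (ltr0Sn R 1))).
exists (size s) => y; apply: contrapT => /card_gt_uniq [u [uu up us]].
pose pr (z : seq_sub u * seq_sub u) := z.1 != z.2.
have [h hsep] : exists h, forall z, pr z ->
    exists2 g, separated e (val z.1) (val z.2) (g + h) & l2norm (Zd_embed R g) <= r.
  apply: (walk _ _ (fun z : seq_sub u * seq_sub u => separated e (val z.1) (val z.2))).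
  move=> [[x xu] [x' x'u]]; rewrite /pr -val_eqE /= => xx'.
  have pxx' : p x = p x' by rewrite (up _ xu) (up _ x'u).
  split; last exact: desc.
  have w'0 : ~ ND_l2_eps T p e w.
    by apply: He; split=> //; rewrite (l2norm1P w).1 //; lra.
  apply: contrapT => ns; apply: w'0; split=> //; exists x, x'; split=> //.
    exact/eqP.
  by move=> g _; rewrite leNgt; apply/negP => gs; apply: ns; exists g.
have /choice [f fP] : forall x, exists z, z \in s /\ forall g,
    l2norm (Zd_embed R g) <= r -> mdist (T g z) (T g (T h x)) < e / 2.
  by move=> x; have [z zs zx] := net (T h x); exists z.
have finj : {in u &, injective f}.
  move=> x x' xu x'u ff; apply/eqP; apply/negPn/negP => xx'.
  have [|g gs gr] := hsep (SeqSub xu, SeqSub x'u); first by rewrite /pr -val_eqE.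
  move: gs => /separatedD; rewrite /separated /= => gs.
  have [_ /(_ g gr) h1] := fP x; have [_ /(_ g gr)] := fP x'; rewrite -ff => h2.
  have := metric_triangle (T g (T h x)) (T g (f x)) (T g (T h x')).
  rewrite (metric_sym (T g (T h x)) (T g (f x))); lra.
have := uniq_leq_size (s1 := map f u) (s2 := s).
rewrite map_inj_in_uniq // size_map => /(_ uu).
rewrite leqNgt us => /(_ _)/notF; apply.
by move=> _ /mapP [x _ ->]; have [] := fP x.
Qed.

End Dynamics.

Lemma convex_l2_horoball {R : realType} {d : nat} (y : 'rV[R]_d) :
  convex_set (l2_horoball y).
Proof.
move=> u v k; rewrite !inE /l2_horoball /= => uy vy.
rewrite dotpDl !dotpZl; have k0 : 0 <= k%:num by []; have k1 : k%:num <= 1 by [].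
have [kz|kz] := eqVneq (k%:num) 0.
  by rewrite kz /unstable.onem subr0 mul0r add0r mul1r.
have : k%:num * dotp u y < 0 by rewrite pmulr_rlt0 // lt_neqAle eq_sym kz.
have : (1 - k%:num) * dotp v y <= 0 by rewrite mulr_ge0_le0 ?subr_ge0 // ltW.
rewrite /unstable.onem; lra.
Qed.

Theorem corollary5p6 (R : realType) (d : nat) (hd : (1 <= d)%N)
    (X Y : metricType R)
    (T : 'rV[int]_d -> X -> X) (S : 'rV[int]_d -> Y -> Y) (p : X -> Y)
    (hT : topological_dynamical_system T)
    (hS : topological_dynamical_system S)
    (hp : factor_map T S p)
    (hnb : ~ bounded_to_one p) :
  convex_hull (ND_l2 T p) 0 /\
  \bigcap_(v in ND_l2 T p) l2_horoball v = set0.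
Proof.
have [cX actT homT] := hT; have [cp _ eqvp] := hp.
have cT g : continuous (T g) by have [] := homT g.
have eqvT g x y : p x = p y -> p (T g x) = p (T g y).
  by move=> pxy; rewrite -!eqvp pxy.
have hull0 : convex_hull (ND_l2 T p) 0.
  move=> B [cB NDB]; apply: contrapT => B0; apply: hnb.
  have cND : compact (ND_l2 T p) by exact: ND_l2_compact.
  have [w [b [w1 b0 NDw]]] := strict_separation _ _ hd cND cB NDB B0.
  exact: bounded_to_one_of_half_space w1 b0 NDw.
split=> //; rewrite -subset0 => y yND.
have : l2_horoball y 0.
  apply: hull0; split; first exact: convex_l2_horoball.
  by move=> v /yND; rewrite /l2_horoball /= dotpC.
by rewrite /l2_horoball /= dotp0l ltxx.
Qed.
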